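(* Let $F_{\alpha,\beta}=\{f^n_{\alpha(n),\beta(n)}\}_{n\in\mathbb{N}_0}$ be an arbitrary Fučík system for the Neumann Laplacian on $(0,\pi)$. Then $F_{\alpha,\beta}$ is $\omega$-linearly independent in $L^2(0,\pi)$; that is, if $\{\eta_n\}_{n\in\mathbb{N}_0}$ is a sequence of real scalars such that $$\lim_{k\to\infty}\Big\|\sum_{n=0}^{k}\eta_n f^n_{\alpha(n),\beta(n)}\Big\|=0,$$ then $\eta_n=0$ for every $n\in\mathbb{N}_0$.
   Context: $L^2(0,\pi)$ is the real Hilbert space with standard scalar product $\langle u,v\rangle=\int_0^\pi uv\,dx$ and norm $\|\cdot\|$; $\mathbb{N}=\{1,2,\dots\}$, $\mathbb{N}_0=\mathbb{N}\cup\{0\}$. For $n\in\mathbb{N}$ let $\Gamma_n=\{(\alpha,\beta): \alpha,\beta>0,\ \frac n2\frac{\pi}{\sqrt\alpha}+\frac n2\frac{\pi}{\sqrt\beta}=\pi\}$. For $(\alpha,\beta)\in\Gamma_n$, the normalized Fučík eigenfunction $f^n_{\alpha,\beta}$ is the $C^2$-solution of $-u''=\alpha u^+-\beta u^-$ in $(0,\pi)$, $u'(0)=u'(\pi)=0$ (where $u^\pm=\max\{\pm u,0\}$) with $f^n_{\alpha,\beta}(0)>0$ and $\sup_{[0,\pi]}|f^n_{\alpha,\beta}|=1$. Explicitly, with $l_1=\pi/\sqrt\alpha$, $l_2=\pi/\sqrt\beta$, $l=l_1+l_2=2\pi/n$, $k\in\mathbb{Z}$: if $\alpha\ge n^2\ge\beta$,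 then $f^n_{\alpha,\beta}(x)=\frac{\sqrt\beta}{\sqrt\alpha}\cos(\sqrt\alpha(x-kl))$ for $kl-\frac{l_1}{2}\le x<kl+\frac{l_1}{2}$ and $f^n_{\alpha,\beta}(x)=-\cos(\sqrt\beta(x-\frac{2k+1}{2}l))$ for $\frac{2k+1}{2}l-\frac{l_2}{2}\le x<\frac{2k+1}{2}l+\frac{l_2}{2}$; if $\beta>n^2>\alpha$, then on the same intervals $f^n_{\alpha,\beta}(x)=\cos(\sqrt\alpha(x-kl))$ and $f^n_{\alpha,\beta}(x)=-\frac{\sqrt\alpha}{\sqrt\beta}\cos(\sqrt\beta(x-\frac{2k+1}{2}l))$, respectively. For $n=0$ set $f^0_{\alpha,\beta}\equiv\frac{\sqrt2}{2}$. A Fučík system is a sequence $F_{\alpha,\beta}=\{f^n_{\alpha(n),\beta(n)}\}_{n\in\mathbb{N}_0}$ where $\alpha,\beta:\mathbb{N}_0\to\mathbb{R}$ satisfy $\alpha(0)=\beta(0)=0$ and $(\alpha(n),\beta(n))\in\Gamma_n$ for every $n\ge1$. *)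

(* Defs.v *)
From HB Require Import structures.
From mathcomp Require Import all_boot all_order all_algebra.
From mathcomp Require Import all_classical all_reals all_analysis.

Set Implicit Arguments.
Unset Strict Implicit.
Unset Printing Implicit Defensive.

Import Order.TTheory GRing.Theory Num.Theory.
Import numFieldNormedType.Exports.

Local Open Scope classical_set_scope.
Local Open Scope ring_scope.

Section Fucik.
Context {R : realType}.
Implicit Types (a b : R) (f : R -> R) (F : nat -> R -> R) (n : nat).

(* Functions on [0, pi] are represented by total functions R -> R; their values
   outside [0, pi] are irrelevant. *)

Definition L2norm f : \bar R :=
  'N[@lebesgue_measure R]_2%:E[(EFin \o f) \_ `]0, pi[].

Definition omega_linearly_independent F : Prop :=
  forall eta : nat -> R,
    L2norm (fun x => \sum_(0 <= n < k.+1) eta n * F n x) @[k --> \oo] --> 0%E ->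
    forall n, eta n = 0.

Definition Gamma n : set (R * R) :=
  [set ab | [/\ 0 < ab.1, 0 < ab.2 &
     n%:R / 2 * (pi / Num.sqrt ab.1) + n%:R / 2 * (pi / Num.sqrt ab.2) = pi]].

(* The Neumann conditions are expressed by one-sided derivatives. Since the
   equation makes f'' bounded, f' and f'' then extend continuously to [0, pi],
   so there is no need to require this separately. *)
Definition fucik_neumann_solution a b f : Prop :=
  [/\ {within `[0, pi], continuous f},
      forall x : R, x \in `]0, pi[ ->
        [/\ derivable f x 1, derivable (derive1 f) x 1,
            {for x, continuous (derive1 (derive1 f))} &
            - (derive1 (derive1 f) x) = a * f^\+ x - b * f^\- x],
      h^-1 * (f h - f 0) @[h --> 0^'+] --> (0 : R) &
      h^-1 * (f (pi + h) - f pi) @[h --> 0^'-] --> (0 : R)].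

Definition normalized_fucik_eigenfunction n a b f : Prop :=
  if n is 0%N then forall x : R, x \in `[0, pi] -> f x = Num.sqrt 2 / 2
  else [/\ fucik_neumann_solution a b f, 0 < f 0 &
           sup [set `|f x| | x in `[0, pi]] = 1].

Definition fucik_system (alpha beta : nat -> R) F : Prop :=
  [/\ alpha 0%N = 0, beta 0%N = 0,
      forall n, (1 <= n)%N -> Gamma n (alpha n, beta n) &
      forall n, normalized_fucik_eigenfunction n (alpha n) (beta n) (F n)].

End Fucik.

(* Main.v *)
(** The cosine coefficients [\int_0^pi f^n cos (j x) dx] form a triangular array:
    they vanish for [0 < j < n] and are nonzero for [j = n], while [f^0] is
    constant. Convergence in L2 to 0 forces every cosine coefficient of the partial
    sums to tend to 0, so [eta_j = 0] for [j >= 1] by strong induction on [j], and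
    then [eta_0 = 0].

    For the triangularity put [h = pi / n]. Uniqueness for the initial value problem
    identifies [f^n] on [[0, h]] with two pieces of cosines, so [f^n] is strictly
    decreasing there and its derivative vanishes at [h]. A solution with vanishing
    derivative at [c] is symmetric about [c], hence [f^n] is symmetric about every
    node [k h]: it is the even [2 h]-periodic folding of its restriction to
    [[0, h]]. *)

Require Import Defs.
From mathcomp Require Import all_boot all_order all_algebra.
From mathcomp Require Import all_classical all_reals all_analysis measurable_realfun.
From mathcomp Require Import ring lra.
Set Implicit Arguments.
Unset Strict Implicit.
Unset Printing Implicit Defensive.
Import Order.TTheory GRing.Theory Num.Theory.
Import numFieldNormedType.Exports.
Local Open Scope classical_set_scope.
Local Open Scope ring_scope.

(** * Uniqueness for second-order autonomous equations *)

Section Uniqueness.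
Context {R : realType}.

Lemma ode2_unique (N u du v dv : R -> R) (L p q : R) : 0 <= L ->
  (forall y z, `|N y - N z| <= L * `|y - z|) ->
  (forall x : R, p < x < q -> is_derive x 1 u (du x)) ->
  (forall x : R, p < x < q -> is_derive x 1 du (N (u x))) ->
  (forall x : R, p < x < q -> is_derive x 1 v (dv x)) ->
  (forall x : R, p < x < q -> is_derive x 1 dv (N (v x))) ->
  u x - v x @[x --> p^'+] --> (0 : R) ->
  du x - dv x @[x --> p^'+] --> (0 : R) ->
  forall x : R, p < x < q -> u x = v x /\ du x = dv x.
Proof.
move=> L0 NL u1 u2 v1 v2 uv0 duv0.
pose E x := (u x - v x) ^+ 2 + (du x - dv x) ^+ 2.
(* Gronwall: [E' <= (1 + L) E]. *)
pose H x := E x * expR (- (1 + L) * x).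
pose dH x := (2 * (u x - v x) * (du x - dv x) + 2 * (du x - dv x) * (N (u x) - N (v x))
  - (1 + L) * E x) * expR (- (1 + L) * x).
have Hd x : p < x < q -> is_derive x 1 H (dH x).
  move=> xpq; have := u1 x xpq; have := u2 x xpq; have := v1 x xpq; have := v2 x xpq.
  move=> h1 h2 h3 h4; rewrite /H /E.
  apply: is_derive_eq; rewrite /dH /E /GRing.scale /=; ring.
have dH0 x : dH x <= 0.
  rewrite /dH pmulr_lle0 ?expR_gt0// /E.
  have := NL (u x) (v x).
  set w := u x - v x; set dw := du x - dv x; set M := N _ - _ => hM.
  (* The target reduces to [2 (1 + L) |w| |dw| <= (1 + L) (w^2 + dw^2)], which is the square
     inequality below. *)
  have : dw * M <= `|dw| * (L * `|w|).
    by rewrite (le_trans (ler_norm _))// normrM ler_wpM2l.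
  rewrite -(real_normK (num_real w)) -(real_normK (num_real dw)).
  have : w * dw <= `|w| * `|dw| by rewrite (le_trans (ler_norm _))// normrM.
  have : 0 <= (`|dw| - `|w|) ^+2 by exact: sqr_ge0.
  move: `|w| `|dw| => W D; nra.
have Hmono : {in `]p, q[ &, {homo H : x y /~ x <= y}}.
  apply: ler0_derive1_le_oo => [x xpq|x xpq|x xpq].
  - by have [] := Hd _ xpq.
  - by rewrite derive1E; have [_ ->] := Hd _ xpq; exact: dH0.
  - move: xpq; rewrite mem_setE /= in_itv/= => xpq.
    by have [/derivable1_diffP/differentiable_continuous] := Hd _ xpq.
have E0 : E x @[x --> p^'+] --> (0 : R).
  have -> : 0 = 0 ^+ 2 + 0 ^+ 2 :> R by rewrite expr0n addr0.
  by apply: cvgD; apply: cvgM.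
have H0 : H x @[x --> p^'+] --> (0 : R).
  rewrite -[X in _ --> X](mul0r (expR (- (1 + L) * p))).
  apply: cvgM => //; apply: cvg_at_right_filter.
  have : {for p, continuous (expR \o *%R (- (1 + L)))}.
    by apply: continuous_comp; [exact: mulrl_continuous|exact: continuous_expR].
  exact.
move=> y ypq.
(* Monotonicity gives [H y <= H x] for every [x] between [p] and [y]; then [x] tends to [p]. *)
have Hy0 : H y <= 0.
  rewrite -(cvg_lim _ H0)//; apply: limr_ge; first by apply/cvg_ex; exists 0.
  near=> x; apply: Hmono => //.
    apply/andP; split; near: x.
      exact: nbhs_right_gt.
    by apply: nbhs_right_lt; move: ypq => /andP[/lt_trans]; apply.
  by near: x; apply: nbhs_right_le; move: ypq => /andP[].
have Ey0 : E y <= 0 by move: Hy0; rewrite /H pmulr_lle0 ?expR_gt0.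
have : (u y - v y) ^+ 2 = 0 /\ (du y - dv y) ^+ 2 = 0.
  by move: Ey0; rewrite /E; have := sqr_ge0 (u y - v y); have := sqr_ge0 (du y - dv y); split; lra.
by move=> [/eqP + /eqP]; rewrite !sqrf_eq0 !subr_eq0 => /eqP -> /eqP ->.
Unshelve. all: by end_near. Qed.

End Uniqueness.

(** * One-sided limits and the Lipschitz right-hand side *)

Section FucikEquation.
Context {R : realType}.
Implicit Types (f u v : R -> R) (a b c p q x t : R).

Lemma is_derive_continuous f x df : is_derive x (1 : R) f df -> {for x, continuous f}.
Proof. by case=> /derivable1_diffP/differentiable_continuous. Qed.

Lemma cvg_right0D f c : {for c, continuous f} -> f (c + t) @[t --> 0^'+] --> f c.
Proof.
move=> cf; apply: cvg_at_right_filter.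
rewrite -[X in _ --> f X]addr0.
apply: (@continuous_comp _ _ _ (+%R c) f) => //; last by rewrite addr0.
by apply: cvgD; [exact: cvg_cst|exact: cvg_id].
Qed.

Lemma cvg_right0B f c : {for c, continuous f} -> f (c - t) @[t --> 0^'+] --> f c.
Proof.
move=> cf; apply: cvg_at_right_filter.
rewrite -[X in _ --> f X]subr0.
apply: (@continuous_comp _ _ _ (fun t => c - t) f) => //; last by rewrite subr0.
by apply: cvgB; [exact: cvg_cst|exact: cvg_id].
Qed.

(** Serves to read off [f] and [df] at the points where the explicit cosine pieces end. *)
Lemma eq_at_left_end u v p c : p < c -> (forall x, p < x < c -> u x = v x) ->
  {for c, continuous u} -> {for c, continuous v} -> u c = v c.
Proof.
move=> pc uv cu cv.
have hu : u x @[x --> c^'-] --> u c by exact: cvg_at_left_filter.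
have hv : v x @[x --> c^'-] --> v c by exact: cvg_at_left_filter.
apply: (cvg_unique _ hu) => //.
apply: cvg_trans hv; apply: near_eq_cvg.
near=> x; apply/esym/uv; apply/andP; split; near: x.
  exact: nbhs_left_gt.
exact: nbhs_left_lt.
Unshelve. all: by end_near. Qed.

(** The Neumann condition controls only the difference quotient at 0, while uniqueness needs the
    limit of the derivative. Two applications of the mean value theorem give [f'(x) = (f(x) - f(0))
    / x + f''(d) (x - c)] with [0 < c < d < x], and the last term is at most [M x] in absolute
    value. *)
Lemma derive1_at_right f (q M : R) : 0 < q ->
  {within `[0, q], continuous f} ->
  (forall x, x \in `]0, q[ -> derivable f x 1 /\ derivable (derive1 f) x 1) ->
  (forall x, x \in `]0, q[ -> `|derive1 (derive1 f) x| <= M) ->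
  h^-1 * (f h - f 0) @[h --> 0^'+] --> (0 : R) ->
  derive1 f x @[x --> 0^'+] --> (0 : R).
Proof.
move=> q0 cf df ddM f0.
apply: norm_cvg0.
have hu : `|x^-1 * (f x - f 0)| + M * x @[x --> 0^'+] --> (0 : R).
  rewrite -[X in _ --> X](addr0 0); apply: cvgD.
    by apply/norm_cvg0P.
  rewrite -[X in _ --> X](mulr0 M); apply: cvg_at_right_filter.
  exact: mulrl_continuous.
apply: (squeeze_cvgr _ (cvg_cst 0) hu).
near=> x; rewrite normr_ge0/=.
have x0 : 0 < x by [].
have xq : x < q by near: x; exact: nbhs_right_lt.
have sub y : 0 < y < x -> y \in `]0, q[.
  by move=> /andP[y0 yx]; rewrite in_itv/= y0 (lt_trans yx).
have [||c] := @MVT _ f (derive1 f) 0 x x0.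
- move=> y; rewrite in_itv/= => /sub/df[h _].
  by rewrite derive1E; exact/derivableP.
- by apply: continuous_subspaceW cf; apply: subset_itvl; rewrite bnd_simp ltW.
rewrite in_itv/= => cx fxE; have /andP[c0 cx'] := cx.
have [||d] := @MVT _ (derive1 f) (derive1 (derive1 f)) c x cx'.
- move=> y; rewrite in_itv/= => /andP[cy yx].
  have [|_ h] := df y; first by apply: sub; rewrite yx (lt_trans c0).
  by rewrite [derive1 (derive1 f) y]derive1E; exact/derivableP.
- apply: derivable_within_continuous => y; rewrite in_itv/= => /andP[cy yx].
  have [|] := df y; last by [].
  by rewrite in_itv/= (lt_le_trans c0 cy) (le_lt_trans yx).
rewrite in_itv/= => /andP[cd dx] dE.
have -> : derive1 f x = x^-1 * (f x - f 0) + derive1 (derive1 f) d * (x - c).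
  by rewrite -dE fxE subr0 mulrC mulfK ?gt_eqF//; ring.
rewrite (le_trans (ler_normD _ _))// lerD2l normrM.
have dM := ddM d (sub _ _).
rewrite [`|x - c|]ger0_norm ?subr_ge0 ?(ltW cx')//.
rewrite ler_pM ?subr_ge0 ?(ltW cx')//; last by rewrite gerBl ltW.
by apply: dM; rewrite dx (lt_trans c0).
Unshelve. all: by end_near. Qed.

(** The differential equation solved for the second derivative: [f'' = fucik_rhs a b f]. *)
Definition fucik_rhs a b y : R := b * Num.max (- y) 0 - a * Num.max y 0.

(** The positive and negative parts are 1-Lipschitz. This makes [ode2_unique] applicable although
    the right-hand side may have a kink at 0. *)
Lemma fucik_rhs_lip a b y z : 0 <= a -> 0 <= b ->
  `|fucik_rhs a b y - fucik_rhs a b z| <= (a + b) * `|y - z|.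
Proof.
move=> a0 b0; rewrite /fucik_rhs.
have h1 : `|Num.max y 0 - Num.max z 0| <= `|y - z|.
  rewrite ler_norml; have := ler_norm (y - z); have := ler_norm (z - y).
  rewrite distrC; move: `|y - z| => W.
  by case: (leP y 0); case: (leP z 0) => ? ? ? ?; apply/andP; split; lra.
have h2 : `|Num.max (- y) 0 - Num.max (- z) 0| <= `|y - z|.
  rewrite ler_norml; have := ler_norm (y - z); have := ler_norm (z - y).
  rewrite distrC; move: `|y - z| => W.
  by case: (leP (- y) 0); case: (leP (- z) 0) => ? ? ? ?; apply/andP; split; lra.
have -> : b * Num.max (- y) 0 - a * Num.max y 0 - (b * Num.max (- z) 0 - a * Num.max z 0) =
  b * (Num.max (- y) 0 - Num.max (- z) 0) - a * (Num.max y 0 - Num.max z 0) by ring.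
rewrite (le_trans (ler_normB _ _))// !normrM (ger0_norm a0) (ger0_norm b0) mulrDl addrC.
by rewrite lerD// ler_wpM2l.
Qed.

End FucikEquation.

(** * Reflection symmetry and the explicit form of a solution on the first half period *)

Section Solution.
Context {R : realType}.
Variables (f df : R -> R) (a b P : R).
Hypotheses (a0 : 0 < a) (b0 : 0 < b).
Hypothesis f1 : forall x : R, 0 < x < P -> is_derive x (1 : R) f (df x).
Hypothesis f2 : forall x : R, 0 < x < P -> is_derive x (1 : R) df (fucik_rhs a b (f x)).
Hypothesis f_right0 : f x @[x --> 0^'+] --> f 0.
Hypothesis df_right0 : df x @[x --> 0^'+] --> (0 : R).
Hypothesis f0_gt0 : 0 < f 0.
(** Half of the period [pi / sqrt a + pi / sqrt b]. In the application [P = pi] and [h = pi / n], so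
    [h = P] occurs for [n = 1]. *)
Variable h : R.
Hypothesis hE : h = pi / 2 / Num.sqrt a + pi / 2 / Num.sqrt b.
Hypothesis hP : h <= P.

Let f_cont (x : R) : 0 < x < P -> {for x, continuous f}.
Proof. by move=> /f1; exact: is_derive_continuous. Qed.

Let df_cont (x : R) : 0 < x < P -> {for x, continuous df}.
Proof. by move=> /f2; exact: is_derive_continuous. Qed.

(** The equation is autonomous and has no first-order term, so [f (c + t)] and [f (c - t)] solve it
    both; since [df c = 0] they share their data at [t = 0]. *)
Lemma solution_reflect c r : 0 <= c - r -> c + r <= P -> 0 < r -> df c = 0 ->
  forall t : R, 0 < t < r -> f (c + t) = f (c - t) /\ df (c + t) = - df (c - t).
Proof.
move=> cr0 crP r0 dfc.
have cP : 0 < c < P by apply/andP; split; lra.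
have tD (t : R) : 0 < t < r -> 0 < c + t < P.
  by move=> /andP[? ?]; apply/andP; split; lra.
have tB (t : R) : 0 < t < r -> 0 < c - t < P.
  by move=> /andP[? ?]; apply/andP; split; lra.
have shD (t : R) : is_derive t 1 (fun t : R => c + t) 1.
  by apply: is_derive_eq; rewrite add0r mulr1.
have shB (t : R) : is_derive t 1 (fun t : R => c - t) (- 1).
  by apply: is_derive_eq; ring.
apply: (@ode2_unique R (fucik_rhs a b) (fun t => f (c + t)) (fun t => df (c + t))
  (fun t => f (c - t)) (fun t => - df (c - t)) (a + b) 0 r).
- by rewrite addr_ge0// ltW.
- by move=> y z; apply: fucik_rhs_lip; exact: ltW.
- by move=> t /tD/f1 ?; rewrite -[df _]mulr1; apply: is_derive1_comp.
- by move=> t /tD/f2 ?; rewrite -[fucik_rhs _ _ _]mulr1; apply: (is_derive1_comp (f := df)).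
- by move=> t /tB/f1 ?; rewrite -[- df _]mulrN1; apply: (is_derive1_comp (f := f)).
- move=> t /tB/f2 ?; rewrite -[fucik_rhs _ _ _]opprK -[- fucik_rhs _ _ _]mulrN1.
  by apply: is_deriveN; apply: (is_derive1_comp (f := df)).
- rewrite -[X in _ --> X](subrr (f c)); apply: cvgB; first by apply: cvg_right0D; exact: f_cont.
  by apply: cvg_right0B; exact: f_cont.
- rewrite [X in _ --> X](_ : 0 = df c - (- df c)); last by rewrite dfc oppr0 subr0.
  apply: cvgB; first by apply: cvg_right0D; exact: df_cont.
  by apply: cvgN; apply: cvg_right0B; exact: df_cont.
Qed.

Let cosw (A s c x : R) : R := A * cos (s * (x - c)).
Let dcosw (A s c x : R) : R := - (A * s * sin (s * (x - c))).

Let is_derive_cosw (A s c x : R) : is_derive x 1 (cosw A s c) (dcosw A s c x).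
Proof. by rewrite /cosw /dcosw; apply: is_derive_eq; rewrite /GRing.scale/=; ring. Qed.

Let is_derive_dcosw (A s c x : R) : is_derive x 1 (dcosw A s c) (- (s ^+ 2 * cosw A s c x)).
Proof. by rewrite /cosw /dcosw; apply: is_derive_eq; rewrite /GRing.scale/=; ring. Qed.

(** The first zero of [f]: half the length [pi / sqrt a] of a full positive bump. *)
Let l1 : R := pi / 2 / Num.sqrt a.

Let sa0 : 0 < Num.sqrt a. Proof. by rewrite sqrtr_gt0. Qed.
Let sb0 : 0 < Num.sqrt b. Proof. by rewrite sqrtr_gt0. Qed.
Let pi2_gt0 : 0 < pi / 2 :> R. Proof. by rewrite divr_gt0// pi_gt0. Qed.
Let l1_gt0 : 0 < l1. Proof. by rewrite divr_gt0. Qed.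
Let l1h : l1 < h. Proof. by rewrite hE ltrDl divr_gt0. Qed.

Let sub_first (x : R) : 0 < x < l1 -> 0 < x < P.
Proof. by move=> /andP[-> xl]/=; rewrite (lt_le_trans _ hP)// (lt_trans xl). Qed.
Let sub_second (x : R) : l1 < x < h -> 0 < x < P.
Proof. by move=> /andP[lx xh]/=; rewrite (lt_trans l1_gt0)//= (lt_le_trans xh). Qed.

Let sal1 : Num.sqrt a * l1 = pi / 2.
Proof. by rewrite mulrC divfK// gt_eqF. Qed.

(** The cosine is positive before [l1], so there the equation reads [u'' = - a u], which the cosine
    solves with value [f 0] and slope 0 at the origin. *)
Let first_piece (x : R) : 0 < x < l1 ->
  f x = cosw (f 0) (Num.sqrt a) 0 x /\ df x = dcosw (f 0) (Num.sqrt a) 0 x.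
Proof.
move=> xl; apply: (@ode2_unique R (fucik_rhs a b) f df (cosw (f 0) (Num.sqrt a) 0)
  (dcosw (f 0) (Num.sqrt a) 0) (a + b) 0 l1 _ _ _ _ _ _ _ _ x xl).
- by rewrite addr_ge0// ltW.
- by move=> y z; apply: fucik_rhs_lip; exact: ltW.
- by move=> {xl} {}x /sub_first; exact: f1.
- by move=> {xl} {}x /sub_first; exact: f2.
- by [].
- move=> {xl} {}x /andP[x0 xl].
  apply: (is_derive_eq (is_derive_dcosw _ _ _ _)).
  rewrite sqr_sqrtr ?(ltW a0)// /fucik_rhs.
  suff : 0 < cosw (f 0) (Num.sqrt a) 0 x.
    by move=> c0; rewrite max_r ?max_l ?oppr_le0 1?ltW// mulr0 add0r.
  rewrite mulr_gt0// cos_gt0_pihalf// subr0 -sal1 ltr_pM2l// xl andbT.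
  by rewrite (@lt_trans _ _ 0) ?oppr_lt0// mulr_gt0.
- rewrite -[X in _ --> X](subrr (f 0)); apply: cvgB => //.
  apply: cvg_at_right_filter.
  rewrite -[X in _ --> X](_ : cosw (f 0) (Num.sqrt a) 0 0 = f 0).
    exact: (is_derive_continuous (is_derive_cosw (f 0) (Num.sqrt a) 0 0)).
  by rewrite /cosw subr0 mulr0 cos0 mulr1.
- rewrite -[X in _ --> X](subrr 0); apply: cvgB => //.
  apply: cvg_at_right_filter.
  rewrite -[X in _ --> X](_ : dcosw (f 0) (Num.sqrt a) 0 0 = 0).
    exact: (is_derive_continuous (is_derive_dcosw (f 0) (Num.sqrt a) 0 0)).
  by rewrite /dcosw subr0 mulr0 sin0 mulr0 oppr0.
Qed.

Let l1P : 0 < l1 < P.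
Proof. by rewrite l1_gt0 (lt_le_trans l1h). Qed.

Let f_l1 : f l1 = 0.
Proof.
rewrite (eq_at_left_end l1_gt0 (fun x xl => (first_piece xl).1)).
- by rewrite /cosw subr0 sal1 cos_pihalf mulr0.
- exact: f_cont.
- exact: is_derive_continuous.
Qed.

Let df_l1 : df l1 = - (f 0 * Num.sqrt a).
Proof.
rewrite (eq_at_left_end l1_gt0 (fun x xl => (first_piece xl).2)).
- by rewrite /dcosw subr0 sal1 sin_pihalf mulr1.
- exact: df_cont.
- exact: is_derive_continuous.
Qed.

Let sbl1 : Num.sqrt b * (l1 - h) = - (pi / 2).
Proof. by rewrite hE opprD addNKr mulrN mulrC divfK// gt_eqF. Qed.

(** Amplitude of the negative bump, chosen so that the slopes of the two cosines agree at [l1]. *)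
Let B : R := - (f 0 * Num.sqrt a / Num.sqrt b).

(** Same argument, restarted at [l1]: the second cosine is negative up to [h], where the equation
    reads [u'' = - b u]. It is centred at [h], so its slope vanishes there. *)
Let second_piece (x : R) : l1 < x < h ->
  f x = cosw B (Num.sqrt b) h x /\ df x = dcosw B (Num.sqrt b) h x.
Proof.
move=> xl; apply: (@ode2_unique R (fucik_rhs a b) f df (cosw B (Num.sqrt b) h)
  (dcosw B (Num.sqrt b) h) (a + b) l1 h _ _ _ _ _ _ _ _ x xl).
- by rewrite addr_ge0// ltW.
- by move=> y z; apply: fucik_rhs_lip; exact: ltW.
- by move=> {xl} {}x /sub_second; exact: f1.
- by move=> {xl} {}x /sub_second; exact: f2.
- by [].
- move=> {xl} {}x /andP[lx xh].
  apply: (is_derive_eq (is_derive_dcosw _ _ _ _)).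
  rewrite sqr_sqrtr ?(ltW b0)// /fucik_rhs.
  suff : cosw B (Num.sqrt b) h x < 0.
    by move=> c0; rewrite max_l ?max_r ?oppr_ge0 1?ltW// mulr0 subr0 mulrN.
  rewrite nmulr_rlt0 ?oppr_lt0 ?divr_gt0 ?mulr_gt0//.
  rewrite cos_gt0_pihalf// -sbl1 ltr_pM2l// ltrD2r lx/=.
  by rewrite (@lt_trans _ _ 0)// nmulr_llt0 ?subr_lt0.
- rewrite -[X in _ --> X](subrr 0); apply: cvgB; apply: cvg_at_right_filter.
    by rewrite -f_l1; exact: f_cont.
  rewrite -[X in _ --> X](_ : cosw B (Num.sqrt b) h l1 = 0).
    exact: (is_derive_continuous (is_derive_cosw B (Num.sqrt b) h l1)).
  by rewrite /cosw sbl1 cosN cos_pihalf mulr0.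
- rewrite -[X in _ --> X](subrr (df l1)); apply: cvgB; apply: cvg_at_right_filter.
    exact: df_cont.
  rewrite -[X in _ --> X](_ : dcosw B (Num.sqrt b) h l1 = df l1).
    exact: (is_derive_continuous (is_derive_dcosw B (Num.sqrt b) h l1)).
  by rewrite /dcosw sbl1 sinN sin_pihalf mulrN1 opprK /B mulNr divfK ?gt_eqF// df_l1.
Qed.

Lemma solution_derive_lt0 (x : R) : 0 < x < h -> df x < 0.
Proof.
move=> /andP[x0 xh].
have [xl|xl|->] := ltgtP x l1.
- have [_ ->] : f x = cosw (f 0) (Num.sqrt a) 0 x /\ df x = dcosw (f 0) (Num.sqrt a) 0 x.
    by apply: first_piece; rewrite x0.
  rewrite oppr_lt0 !mulr_gt0// sin_gt0_pihalf// subr0 mulr_gt0//=.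
  by rewrite -sal1 ltr_pM2l.
- have [_ ->] : f x = cosw B (Num.sqrt b) h x /\ df x = dcosw B (Num.sqrt b) h x.
    by apply: second_piece; rewrite xl.
  have -> : dcosw B (Num.sqrt b) h x =
      - (f 0 * Num.sqrt a / Num.sqrt b * Num.sqrt b * sin (Num.sqrt b * (h - x))).
    rewrite /dcosw /B -[x - h]opprB mulrN sinN; ring.
  rewrite oppr_lt0 mulr_gt0// ?mulr_gt0 ?invr_gt0//.
  apply: sin_gt0_pihalf; rewrite mulr_gt0 ?subr_gt0//=.
  by rewrite -[ltRHS]opprK -sbl1 -mulrN opprB ltr_pM2l// ltrD2l ltrN2.
- by rewrite df_l1 oppr_lt0 mulr_gt0.
Qed.

Lemma solution_derive_half_period : h < P -> df h = 0.
Proof.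
move=> hltP.
rewrite (eq_at_left_end l1h (fun x xl => (second_piece xl).2)).
- by rewrite /dcosw subrr mulr0 sin0 mulr0 oppr0.
- by apply: df_cont; rewrite (lt_trans l1_gt0).
- exact: is_derive_continuous.
Qed.

End Solution.

(** * Folding of the eigenfunction about the nodes [k h] *)

Section Eigenfunction.
Context {R : realType}.

(** Reflection about the node [(k + 1) h] carries [k h] to [(k + 2) h], so a vanishing derivative
    propagates two nodes ahead. *)
Lemma solution_derive_nodes (f df : R -> R) (a b h : R) (n : nat) :
  0 < a -> 0 < b -> 0 < h ->
  (forall x : R, 0 < x < n%:R * h -> is_derive x (1 : R) f (df x)) ->
  (forall x : R, 0 < x < n%:R * h -> is_derive x (1 : R) df (fucik_rhs a b (f x))) ->
  df x @[x --> 0^'+] --> (0 : R) ->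
  (h < n%:R * h -> df h = 0) ->
  forall k : nat, (0 < k < n)%N -> df (k%:R * h) = 0.
Proof.
move=> a0 b0 h0 f1 f2 df0 dfh.
(* The induction carries two consecutive nodes: the centre of the reflection and the node to be
   reflected. *)
suff H k : ((0 < k < n)%N -> df (k%:R * h) = 0) /\ ((k.+1 < n)%N -> df (k.+1%:R * h) = 0).
  by move=> k; exact: (H k).1.
elim: k => [|k [IH0 IH1]].
  by split => // n1; rewrite mul1r; apply: dfh; rewrite ltr_pMl// ltr1n.
split => [|kn]; first by case/andP => _; exact: IH1.
have kn' : (k.+1 < n)%N by exact: ltnW.
set c := k.+1%:R * h.
have cE : k.+2%:R * h = c + h by rewrite /c -[k.+2]addn1 natrD mulrDl mul1r.
have c'E : k%:R * h = c - h by rewrite /c -[k.+1]addn1 natrD mulrDl mul1r addrK.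
have chP : c + h < n%:R * h by rewrite -cE ltr_pM2r// ltr_nat.
have cB : 0 <= c - h by rewrite -c'E mulr_ge0// ltW.
have refl := solution_reflect a0 b0 f1 f2 cB (ltW chP) h0 (IH1 kn').
rewrite cE.
have dfch : df (c + h - t) @[t --> 0^'+] --> df (c + h).
  apply: cvg_right0B; apply: is_derive_continuous (f2 _ _).
  by rewrite chP andbT; lra.
(* The reflection holds only strictly inside the two cells, so the end [c + h] is reached as a
   limit. *)
have : df (c + h - t) @[t --> 0^'+] --> (0 : R).
  have low : - df (c - h + t) @[t --> 0^'+] --> (0 : R).
    rewrite -[X in _ --> X]oppr0; apply: cvgN; rewrite -c'E.
    (* For [k = 0] the reflected node is the endpoint 0, where only the right limit of [df] is
       known. *)
    case: (posnP k) => [->|k0].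
      by rewrite mul0r; under eq_fun do rewrite add0r.
    rewrite -[X in _ --> X]IH0 ?k0 ?(ltnW kn')//.
    apply: cvg_right0D; apply: is_derive_continuous (f2 _ _).
    by rewrite c'E; apply/andP; split; [rewrite -c'E mulr_gt0 ?ltr0n|lra].
  apply: cvg_trans low; apply: near_eq_cvg; near=> t.
  have t0 : 0 < t by [].
  have th : t < h by near: t; exact: nbhs_right_lt.
  have [|_] := refl (h - t); first by apply/andP; split; lra.
  rewrite addrA opprB [c + (t - h)]addrCA [t + _]addrC => ->.
  by congr (- df _); ring.
exact: cvg_unique.
Unshelve. all: by end_near. Qed.

(** Reflection about the left node of a cell maps it to the preceding cell and turns [t] into
    [h - t], which flips the parity. *)
Lemma solution_fold (f df : R -> R) (a b h : R) (n : nat) :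
  0 < a -> 0 < b -> 0 < h ->
  (forall x : R, 0 < x < n%:R * h -> is_derive x (1 : R) f (df x)) ->
  (forall x : R, 0 < x < n%:R * h -> is_derive x (1 : R) df (fucik_rhs a b (f x))) ->
  (forall k : nat, (0 < k < n)%N -> df (k%:R * h) = 0) ->
  forall (k : nat) (t : R), (k < n)%N -> 0 < t < h ->
  f (k%:R * h + t) = if odd k then f (h - t) else f t.
Proof.
move=> a0 b0 h0 f1 f2 df0; elim => [|k IH] t kn th.
  by rewrite mul0r add0r.
set c := k.+1%:R * h.
have c'E : k%:R * h = c - h by rewrite /c -[k.+1]addn1 natrD mulrDl mul1r addrK.
have chP : c + h <= n%:R * h.
  by rewrite /c -[X in _ + X]mul1r -mulrDl -(natrD _ _ 1) addn1 ler_pM2r// ler_nat.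
have cB : 0 <= c - h by rewrite -c'E mulr_ge0// ltW.
have [-> _] := solution_reflect a0 b0 f1 f2 cB chP h0 (df0 k.+1 kn) th.
have -> : c - t = k%:R * h + (h - t) by rewrite c'E; ring.
rewrite IH ?(ltnW kn)//; last by apply/andP; move: th => /andP[? ?]; split; lra.
by rewrite /= subKr; case: odd.
Qed.

Lemma eigenfunction_fold (f : R -> R) (a b : R) (n : nat) : (0 < n)%N ->
  Gamma n (a, b) -> fucik_neumann_solution a b f -> 0 < f 0 ->
  [/\ forall x : R, 0 < x < pi -> is_derive x (1 : R) f (derive1 f x),
      forall x : R, 0 < x < pi / n%:R -> derive1 f x < 0 &
      forall (k : nat) (t : R), (k < n)%N -> 0 < t < pi / n%:R ->
        f (k%:R * (pi / n%:R) + t) = if odd k then f (pi / n%:R - t) else f t].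
Proof.
move=> n0 [/= a0 b0 abn] [cf f12 f0 _] f0_gt0.
set h := pi / n%:R.
have nR0 : 0 < n%:R :> R by rewrite ltr0n.
have h0 : 0 < h by rewrite divr_gt0 ?pi_gt0.
have nh : n%:R * h = pi by rewrite mulrC divfK ?gt_eqF.
have inpi (x : R) : 0 < x < pi -> x \in `]0, pi[ by rewrite in_itv.
have f1 (x : R) : 0 < x < pi -> is_derive x (1 : R) f (derive1 f x).
  by move=> /inpi/f12[? _ _ _]; rewrite derive1E; exact/derivableP.
have d2E (x : R) : 0 < x < pi -> derive1 (derive1 f) x = fucik_rhs a b (f x).
  by move=> /inpi/f12[_ _ _ /eqP]; rewrite eqr_oppLR opprB => /eqP ->.
have f2 (x : R) : 0 < x < pi -> is_derive x (1 : R) (derive1 f) (fucik_rhs a b (f x)).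
  move=> xpi; rewrite -(d2E _ xpi) [derive1 (derive1 f) x]derive1E.
  by have [_ ? _ _] := f12 _ (inpi _ xpi); exact/derivableP.
have fr0 : f x @[x --> 0^'+] --> f 0.
  by have [_] := (continuous_within_itvP f (pi_gt0 R)).1 cf.
have dr0 : derive1 f x @[x --> 0^'+] --> (0 : R).
  (* A bound for [f'']: the extrema bound [f], and the Lipschitz estimate is used against
     [fucik_rhs a b 0 = 0]. *)
  have [c1 _ c1P] := EVT_max (pi_ge0 R) cf.
  have [c2 _ c2P] := EVT_min (pi_ge0 R) cf.
  apply: (@derive1_at_right _ f pi ((a + b) * (`|f c1| + `|f c2|))) => //.
  - exact: pi_gt0.
  - by move=> x /f12[].
  - move=> x xpi; rewrite d2E; last by move: xpi; rewrite in_itv.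
    have -> : fucik_rhs a b (f x) = fucik_rhs a b (f x) - fucik_rhs a b 0.
      by rewrite [X in _ - X]/fucik_rhs oppr0 maxxx !mulr0 !subr0.
    rewrite (le_trans (fucik_rhs_lip _ _ (ltW a0) (ltW b0)))// subr0.
    rewrite ler_wpM2l ?addr_ge0 ?(ltW a0) ?(ltW b0)//.
    have xcc : x \in `[0, pi] by apply: subset_itv_oo_cc.
    have := c1P _ xcc; have := c2P _ xcc.
    have := ler_norm (f c1); have := ler_norm (- f c2); rewrite normrN.
    have := normr_ge0 (f c1); have := normr_ge0 (f c2).
    by rewrite ler_norml => ? ? ? ? ? ?; apply/andP; split; lra.
(* This is the equation of [Gamma n] divided by [n]. *)
have hE : h = pi / 2 / Num.sqrt a + pi / 2 / Num.sqrt b.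
  apply: (mulfI (lt0r_neq0 nR0)); rewrite nh -{1}abn.
  have : Num.sqrt a != 0 by rewrite gt_eqF// sqrtr_gt0.
  have : Num.sqrt b != 0 by rewrite gt_eqF// sqrtr_gt0.
  by move=> ? ?; field; apply/andP.
have hpi : h <= pi by rewrite -nh ler_pMl// ler1n.
split=> //.
  by move=> x xh; exact: (solution_derive_lt0 a0 b0 f1 f2 fr0 dr0 f0_gt0 hE hpi xh).
apply: (@solution_fold f (derive1 f) a b) => //; rewrite ?nh//.
apply: (@solution_derive_nodes f (derive1 f) a b) => //; rewrite ?nh//.
exact: (solution_derive_half_period a0 b0 f1 f2 fr0 dr0 f0_gt0 hE hpi).
Qed.

End Eigenfunction.

(** * Extensions, primitives, and moments of folded functions *)

Section Coefficients.
Context {R : realType}.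
Notation mu := (@lebesgue_measure R).

(** Composition with the projection onto [[p, q]]. A function continuous on the whole line has
    primitives with two-sided derivatives at 0 and [pi] too. *)
Lemma continuous_clamp_extension (f : R -> R) (p q : R) : p <= q ->
  {within `[p, q], continuous f} ->
  exists2 g : R -> R, continuous g & forall x : R, p <= x <= q -> g x = f x.
Proof.
move=> pq cf; pose clamp x := Num.max p (Num.min q x).
have clamp_in x : `[p, q]%classic (clamp x).
  by rewrite /= in_itv/= /clamp le_max lexx ge_max pq ge_min lexx.
exists (f \o clamp).
  move=> x; apply: (@cvg_comp _ _ _ clamp f _ (within `[p, q] (nbhs (clamp x)))).
    move=> A wA; have : \forall y \near x, clamp y \in `[p, q] -> A (clamp y).
      have cc : {for x, continuous clamp}.
        apply: continuous_max; first exact: cvg_cst.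
        by apply: continuous_min; [exact: cvg_cst|exact: cvg_id].
      exact: (cc _ wA).
    by apply: filterS => y; apply; exact: clamp_in.
  by move/subspace_continuousP : cf; apply; exact: clamp_in.
move=> x /andP[px xq] /=; congr (f _).
by rewrite /clamp min_r// max_r.
Qed.

Lemma primitive_exists (g : R -> R) (p q : R) : continuous g ->
  exists G : R -> R, forall x : R, p < x < q -> is_derive x (1 : R) G (g x).
Proof.
move=> cg; exists (fun x => \int[mu]_(t in [set` `[p, x]]) g t)%R => x /andP[px xq].
have ig : mu.-integrable `[p, q] (EFin \o g).
  apply: continuous_compact_integrable; first exact: segment_compact.
  exact: continuous_subspaceT.
have [dG dE] := continuous_FTC1_closed xq ig px (cg x).
by rewrite -dE derive1E; exact/derivableP.
Qed.

Lemma derive0_constant (K k : R -> R) (p q : R) : p < q ->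
  (forall x : R, p <= x <= q -> is_derive x (1 : R) K (k x)) ->
  (forall x : R, p < x < q -> k x = 0) -> K q = K p.
Proof.
move=> pq dK k0.
have [|x|x] := @MVT _ K k p q pq.
- by move=> x; rewrite in_itv/= => /andP[px xq]; apply: dK; rewrite !ltW.
- apply: derivable_within_continuous => {}x; rewrite in_itv/= => /dK.
  by case.
- rewrite in_itv/= => /k0 ->; rewrite mul0r => /eqP.
  by rewrite subr_eq0 => /eqP.
Qed.

Section Fold.
Variables (g G S : R -> R) (j h : R) (n : nat).
Hypothesis h0 : 0 < h.
Hypothesis gfold : forall (k : nat) (t : R), (k < n)%N -> 0 < t < h ->
  g (k%:R * h + t) = if odd k then g (h - t) else g t.
Hypothesis dG : forall x : R, 0 <= x <= n%:R * h ->
  is_derive x (1 : R) G (g x * cos (j * x)).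
Hypothesis dS : forall x : R, 0 <= x <= n%:R * h ->
  is_derive x (1 : R) S (g x * sin (j * x)).
(** [C] and [D] are the cosine and sine moments of [g] over the first cell. *)
Let C := G h - G 0.
Let D := S h - S 0.

(** A change of variable back to the first cell followed by the addition formula for the cosine.
    Instead of substituting in integrals, a combination [K] of primitives is shown to be
    constant. *)
Lemma fold_increment (k : nat) : (k < n)%N ->
  G (k.+1%:R * h) - G (k%:R * h) =
  if odd k then cos (k.+1%:R * (j * h)) * C + sin (k.+1%:R * (j * h)) * D
  else cos (k%:R * (j * h)) * C - sin (k%:R * (j * h)) * D.
Proof.
move=> kn.
have kE : k.+1%:R * h = k%:R * h + h by rewrite -[k.+1]addn1 natrD mulrDl mul1r.
have khn : k%:R * h + h <= n%:R * h by rewrite -kE ler_pM2r// ler_nat.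
have kh0 : 0 <= k%:R * h by rewrite mulr_ge0// ltW.
have shD (t : R) : is_derive t 1 (fun t : R => k%:R * h + t) 1.
  by apply: is_derive_eq; ring.
have shB (t : R) : is_derive t 1 (fun t : R => h - t) (- 1).
  by apply: is_derive_eq; ring.
have dGD (t : R) : 0 <= t <= h -> is_derive t 1 (fun t : R => G (k%:R * h + t))
    (g (k%:R * h + t) * cos (j * (k%:R * h + t))).
  move=> /andP[? ?]; rewrite -[_ * cos _]mulr1; apply: (is_derive1_comp (f := G)).
  by apply: dG; apply/andP; split; lra.
have dGt (t : R) : 0 <= t <= h -> is_derive t 1 G (g t * cos (j * t)).
  by move=> /andP[? ?]; apply: dG; apply/andP; split; lra.
have dSt (t : R) : 0 <= t <= h -> is_derive t 1 S (g t * sin (j * t)).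
  by move=> /andP[? ?]; apply: dS; apply/andP; split; lra.
have revh (t : R) : 0 <= t <= h -> 0 <= h - t <= h.
  by move=> /andP[? ?]; apply/andP; split; lra.
have dGB (t : R) : 0 <= t <= h -> is_derive t 1 (fun t : R => G (h - t))
    (- (g (h - t) * cos (j * (h - t)))).
  move=> /revh/dGt ?; rewrite -[X in is_derive _ _ _ X]mulrN1.
  exact: (is_derive1_comp (f := G)).
have dSB (t : R) : 0 <= t <= h -> is_derive t 1 (fun t : R => S (h - t))
    (- (g (h - t) * sin (j * (h - t)))).
  move=> /revh/dSt ?; rewrite -[X in is_derive _ _ _ X]mulrN1.
  exact: (is_derive1_comp (f := S)).
have fold t := @gfold k t kn.
move: fold; case: ifPn => ok fold.
- set cc := cos _; set ss := sin _.
  (* On an odd cell the phase is written as [(k + 1) j h - j (h - t)], matching the reversed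
     argument of [g]. *)
  pose K t := G (k%:R * h + t) + cc * G (h - t) + ss * S (h - t).
  pose K' t := g (k%:R * h + t) * cos (j * (k%:R * h + t)) -
    cc * (g (h - t) * cos (j * (h - t))) - ss * (g (h - t) * sin (j * (h - t))).
  have : K h = K 0.
    apply: (@derive0_constant K K') => //.
      move=> t th; have ? := dGD t th; have ? := dGB t th; have ? := dSB t th.
      by rewrite /K; apply: is_derive_eq; rewrite /K' /GRing.scale/=; ring.
    move=> t th; rewrite /K' fold//.
    have -> : j * (k%:R * h + t) = k.+1%:R * (j * h) - j * (h - t).
      by rewrite -[k.+1]addn1 natrD; ring.
    by rewrite cosB /cc /ss; ring.
  by rewrite /K subrr subr0 addr0 kE /C /D => KE; lra.
- set cc := cos _; set ss := sin _.
  pose K t := G (k%:R * h + t) - cc * G t + ss * S t.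
  pose K' t := g (k%:R * h + t) * cos (j * (k%:R * h + t)) -
    cc * (g t * cos (j * t)) + ss * (g t * sin (j * t)).
  have : K h = K 0.
    apply: (@derive0_constant K K') => //.
      move=> t th; have ? := dGD t th; have ? := dGt t th; have ? := dSt t th.
      by rewrite /K; apply: is_derive_eq; rewrite /K' /GRing.scale/=; ring.
    move=> t th; rewrite /K' fold//.
    have -> : j * (k%:R * h + t) = k%:R * (j * h) + j * t by ring.
    by rewrite cosD /cc /ss; ring.
  by rewrite /K addr0 kE /C /D => KE; lra.
Qed.

(* Multiplying by [sin (j h)] makes the sum of the increments telescope; at [k = n] the
   right-hand side contains [sin (j pi) = 0]. *)
Lemma fold_partial_sum (k : nat) : (k <= n)%N ->
  sin (j * h) * (G (k%:R * h) - G 0) =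
  sin (k%:R * (j * h)) * (if odd k then C else cos (j * h) * C + sin (j * h) * D).
Proof.
elim: k => [_|k IH kn]; first by rewrite !mul0r subrr mulr0 sin0 mul0r.
have -> : G (k.+1%:R * h) - G 0 =
  (G (k.+1%:R * h) - G (k%:R * h)) + (G (k%:R * h) - G 0) by ring.
rewrite mulrDr IH ?(ltnW kn)// fold_increment//=.
have kE : k.+1%:R * (j * h) = k%:R * (j * h) + j * h.
  by rewrite -[k.+1]addn1 natrD mulrDl mul1r.
case: ifPn => ok /=.
  have -> : k%:R * (j * h) = k.+1%:R * (j * h) - j * h by rewrite kE addrK.
  by rewrite sinB; ring.
by rewrite kE sinD; ring.
Qed.

End Fold.

Lemma sin_natpi (k : nat) : sin (k%:R * pi) = 0 :> R.
Proof.
elim: k => [|k IH]; first by rewrite mul0r sin0.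
by rewrite -[k.+1]addn1 natrD mulrDl mul1r sinDpi IH oppr0.
Qed.

Lemma cos_natpi (k : nat) : cos (k%:R * pi) = (-1) ^+ odd k :> R.
Proof.
elim: k => [|k IH]; first by rewrite mul0r cos0.
by rewrite -[k.+1]addn1 natrD mulrDl mul1r cosDpi IH addn1 /= signrN.
Qed.

End Coefficients.

(** * Cosine coefficients and their continuity in the L2 norm *)

Section CosineCoefficient.
Context {R : realType}.
Notation mu := (@lebesgue_measure R).

Definition cos_coef (f : R -> R) (j : nat) : R :=
  \int[mu]_(x in `[0, pi]) (f x * cos (j%:R * x)).

Lemma is_derive_mulrl (j x : R) : is_derive x 1 ( *%R j) j.
Proof. by apply: is_derive_eq; rewrite /GRing.scale/= mulr1. Qed.

Lemma continuous_cos_mul (j : R) : continuous (fun x : R => cos (j * x)).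
Proof.
move=> x; have ? := is_derive_mulrl j x.
by apply: (@is_derive_continuous _ (cos \o *%R j)); exact: is_derive1_comp.
Qed.

Lemma continuous_sin_mul (j : R) : continuous (fun x : R => sin (j * x)).
Proof.
move=> x; have ? := is_derive_mulrl j x.
by apply: (@is_derive_continuous _ (sin \o *%R j)); exact: is_derive1_comp.
Qed.

Lemma cos_coef_integrable (f : R -> R) (j : nat) :
  {within `[0, pi], continuous f} ->
  mu.-integrable `[0, pi] (EFin \o (fun x => f x * cos (j%:R * x))).
Proof.
move=> cf; apply: continuous_compact_integrable; first exact: segment_compact.
move=> x; apply: cvgM; first exact: cf.
by apply: continuous_subspaceT; exact: continuous_cos_mul.
Qed.

Lemma cos_coefE (f g G : R -> R) (j : nat) :
  continuous g -> (forall x : R, 0 <= x <= pi -> g x = f x) ->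
  (forall x : R, 0 <= x <= pi -> is_derive x (1 : R) G (g x * cos (j%:R * x))) ->
  cos_coef f j = G pi - G 0.
Proof.
move=> cg gf dG; rewrite /cos_coef.
rewrite (@eq_Rintegral _ _ _ mu _ (fun x => g x * cos (j%:R * x))); last first.
  by move=> x; rewrite inE/= in_itv/= => /gf ->.
rewrite /Rintegral (@continuous_FTC2 _ _ G) ?pi_gt0//.
- apply: continuous_subspaceT => x; apply: continuousM; first exact: cg.
  exact: continuous_cos_mul.
- split.
  + by move=> x; rewrite in_itv/= => /andP[x0 xpi]; case: (dG x _) => //; rewrite !ltW.
  + apply: cvg_at_right_filter; apply: is_derive_continuous (dG _ _).
    by rewrite lexx pi_ge0.
  + apply: cvg_at_left_filter; apply: is_derive_continuous (dG _ _).
    by rewrite lexx pi_ge0.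
- move=> x; rewrite in_itv/= => /andP[x0 xpi]; rewrite derive1E.
  by case: (dG x _) => //; rewrite !ltW.
Qed.

(** Continuity is carried along in the induction because additivity of the integral needs integrable
    partial sums. *)
Lemma cos_coef_sum (F : nat -> R -> R) (eta : nat -> R) (j k : nat) :
  (forall n, {within `[0, pi], continuous (F n)}) ->
  {within `[0, pi], continuous (fun x => \sum_(0 <= n < k) eta n * F n x)} /\
  cos_coef (fun x => \sum_(0 <= n < k) eta n * F n x) j =
  \sum_(0 <= n < k) eta n * cos_coef (F n) j.
Proof.
move=> cF; elim: k => [|k [cS IH]].
  have -> : (fun x => \sum_(0 <= n < 0) eta n * F n x) = cst 0.
    by apply/funext => x; rewrite big_geq.
  rewrite big_geq//; split; first by move=> x; exact: cvg_cst.
  rewrite /cos_coef (@eq_Rintegral _ _ _ mu _ (cst 0)) => [|x _]; last by rewrite mul0r.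
  by rewrite Rintegral_cst// mul0r.
have -> : (fun x => \sum_(0 <= n < k.+1) eta n * F n x) =
    (fun x => \sum_(0 <= n < k) eta n * F n x + eta k * F k x).
  by apply/funext => x; rewrite big_nat_recr.
have cT : {within `[0, pi], continuous (fun x => eta k * F k x)}.
  by move=> x; apply: cvgM; [exact: cvg_cst|exact: cF].
split; first by move=> x; apply: cvgD; [exact: cS|exact: cT].
rewrite big_nat_recr//= -IH /cos_coef.
under eq_Rintegral do rewrite mulrDl.
rewrite RintegralD//; [|exact: cos_coef_integrable|exact: cos_coef_integrable].
congr (_ + _); under eq_Rintegral do rewrite -mulrA.
by rewrite RintegralZl//; exact: cos_coef_integrable.
Qed.

(** The cosine is bounded by 1, and Hoelder with exponents 2 and 2 compares the L1 norm of [f] with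
    its L2 norm. *)
Lemma cos_coef_L2norm (f : R -> R) (j : nat) :
  {within `[0, pi], continuous f} ->
  (`|cos_coef f j|%:E <= L2norm f * 'N[mu]_2%:E[EFin \o \1_(`]0%R, pi[)])%E.
Proof.
move=> cf; pose D := (`]0%R, pi[%classic : set R).
have mD : measurable D by exact: measurable_itv.
have mI : measurable (`[0%R, pi]%classic : set R) by exact: measurable_itv.
have iI : mu.-integrable `[0, pi] (EFin \o f).
  by apply: continuous_compact_integrable => //; exact: segment_compact.
have iD : mu.-integrable D (EFin \o f).
  by apply: integrableS iI => //; exact: subset_itv_oo_cc.
have mfD : measurable_fun D f by apply/measurable_EFinP; exact: (measurable_int mu).
have mfI : measurable_fun `[0, pi] f by apply/measurable_EFinP; exact: (measurable_int mu).
have ic := cos_coef_integrable j cf.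
have mc := measurable_int mu ic.
rewrite EFin_normr_Rintegral//.
apply: (le_trans (le_abse_integral _ _ _)) => //.
have step1 : (\int[mu]_(x in `[0%R, pi]) `|(f x * cos (j%:R * x))%R%:E| <=
    \int[mu]_(x in `[0%R, pi]) `|(f x)%:E|)%E.
  apply: ge0_le_integral => //.
  - exact: measurableT_comp.
  - by apply: measurableT_comp => //; exact/measurable_EFinP.
  - move=> x _; rewrite !abse_EFin lee_fin normrM ler_piMr//.
    by rewrite ler_norml cos_geN1 cos_le1.
apply: (le_trans step1).
(* Dropping the endpoints matches the open interval in [L2norm]. *)
rewrite integral_itv_bndoo; last first.
  by apply: measurableT_comp => //; exact/measurable_EFinP.
have mfT : measurable_fun setT (f \_ D) by apply/(measurable_restrictT f mD).
have mDT : measurable_fun setT (\1_D : R -> R) by exact: measurable_indic.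
have pq : 2^-1 + 2^-1 = 1 :> R by lra.
have H := hoelder mu mfT mDT (ltr0n _ 2) (ltr0n _ 2) pq.
rewrite /L2norm restrict_EFin; apply: (le_trans _ H).
rewrite Lnorm1 [leLHS]integral_mkcond le_eqVlt; apply/orP; left; apply/eqP.
apply: eq_integral => x _ /=; rewrite !patchE indicE.
by case: ifPn => _; rewrite ?mulr1// mul0r normr0.
Qed.

(** Finiteness of this factor lets the extended-real bound tend to 0 with [L2norm]. *)
Lemma Lnorm2_indic_lty : ('N[mu]_2%:E[EFin \o \1_(`]0%R, pi[)] < +oo)%E.
Proof.
rewrite unlock; apply: poweR_lty.
rewrite (@eq_integral _ _ _ mu setT (EFin \o \1_(`]0%R, pi[))).
  rewrite integral_indic//= setIT lebesgue_measure_itv/=.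
  by case: ifP => _; rewrite ltry.
move=> x _ /=; rewrite indicE; case: (_ \in _).
  by rewrite normr1 powR1.
by rewrite normr0 powR0.
Qed.

Lemma cos_coef_cvg0 (s : nat -> R -> R) (j : nat) :
  (forall k, {within `[0, pi], continuous (s k)}) ->
  L2norm (s k) @[k --> \oo] --> 0%E -> cos_coef (s k) j @[k --> \oo] --> (0 : R).
Proof.
move=> cs s0; set M := ('N[mu]_2%:E[EFin \o \1_(`]0%R, pi[)])%E.
have Mfin : M \is a fin_num by rewrite ge0_fin_numE ?Lnorm_ge0// Lnorm2_indic_lty.
have sM : (L2norm (s k) * M)%E @[k --> \oo] --> 0%E.
  by rewrite -(mul0e M); apply: cvgeZr.
apply: norm_cvg0.
have /fine_cvgP[_] : (fun k => `|cos_coef (s k) j|%:E) @ \oo --> 0%:E; last by [].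
apply: (squeeze_cvge _ (cvg_cst 0%E) sM).
by apply: nearW => k; rewrite lee_fin normr_ge0/= cos_coef_L2norm.
Qed.

End CosineCoefficient.

(** * Triangularity of the coefficients and the conclusion *)

Section Main.
Context {R : realType}.

Lemma eigenfunction_cos_coef (f : R -> R) (a b : R) (n : nat) : (0 < n)%N ->
  Gamma n (a, b) -> fucik_neumann_solution a b f -> 0 < f 0 ->
  (forall j, (0 < j < n)%N -> cos_coef f j = 0) /\ cos_coef f n != 0.
Proof.
move=> n0 gn sol f0; have [cf _ _ _] := sol.
have [f1 fneg ffold] := eigenfunction_fold n0 gn sol f0.
set h := pi / n%:R in fneg ffold.
have nR0 : 0 < n%:R :> R by rewrite ltr0n.
have h0 : 0 < h by rewrite divr_gt0 ?pi_gt0.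
have nh : n%:R * h = pi by rewrite mulrC divfK ?gt_eqF.
have hpi : h <= pi by rewrite -nh ler_pMl// ler1n.
have [g cg gf] := continuous_clamp_extension (pi_ge0 R) cf.
have gfold (k : nat) (t : R) : (k < n)%N -> 0 < t < h ->
    g (k%:R * h + t) = if odd k then g (h - t) else g t.
  move=> kn /[dup] th /andP[t0 th'].
  have tpi : 0 <= t <= pi by apply/andP; split; lra.
  have htpi : 0 <= h - t <= pi by apply/andP; split; lra.
  have kpi : 0 <= k%:R * h + t <= pi.
    apply/andP; split.
      by apply: addr_ge0; [rewrite mulr_ge0// ltW|exact: ltW].
    apply: (@le_trans _ _ (k.+1%:R * h)).
      by rewrite -[k.+1]addn1 natrD mulrDl mul1r lerD2l ltW.
    by rewrite -nh ler_pM2r// ler_nat.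
  by rewrite (gf _ kpi) (gf _ tpi) (gf _ htpi); exact: ffold.
have prim (w : R -> R) : continuous w ->
    exists W : R -> R, forall x : R, 0 <= x <= n%:R * h ->
      is_derive x (1 : R) W (g x * w x).
  move=> cw; have cgw : continuous (fun x => g x * w x).
    by move=> x; apply: continuousM; [exact: cg|exact: cw].
  (* The margin of 1 on each side puts 0 and [pi] inside the open interval. *)
  have [W dW] := primitive_exists (-1) (pi + 1) cgw.
  by exists W => x; rewrite nh => /andP[? ?]; apply: dW; apply/andP; split; lra.
split=> [j /andP[j0 jn]|].
  have [G dG] := prim _ (@continuous_cos_mul _ j%:R).
  have [S dS] := prim _ (@continuous_sin_mul _ j%:R).
  have dGpi := dG; rewrite nh in dGpi; rewrite (cos_coefE cg gf dGpi).
  have := fold_partial_sum h0 gfold dG dS (leqnn n).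
  have -> : n%:R * (j%:R * h) = j%:R * pi by rewrite mulrCA nh.
  (* The right-hand side contains [sin (j pi) = 0], whereas [sin (j h) > 0] because [0 < j h < pi];
     hence the increment of [G] vanishes. *)
  rewrite nh sin_natpi mul0r => /eqP; rewrite mulf_eq0 => /orP[|/eqP//].
  rewrite gt_eqF//; apply: sin_gt0_pi; rewrite mulr_gt0 ?ltr0n//= -nh.
  by rewrite ltr_pM2r// ltr_nat.
have [G dG] := prim _ (@continuous_cos_mul _ n%:R).
have [S dS] := prim _ (@continuous_sin_mul _ n%:R).
have dGpi := dG; rewrite nh in dGpi; rewrite (cos_coefE cg gf dGpi).
(* For [j = n] one has [j h = pi], so the telescoping factor is 0. Instead the cells are added
   directly: the sine terms vanish, the cosine is taken at an even multiple of [pi], and every cell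
   contributes the same amount. *)
have Gk (k : nat) : (k <= n)%N -> G (k%:R * h) - G 0 = k%:R * (G h - G 0).
  elim: k => [|k IH] kn; first by rewrite !mul0r subrr.
  have := fold_increment h0 gfold dG dS kn; rewrite nh !sin_natpi !cos_natpi.
  rewrite !mul0r subr0 addr0 /= => inc.
  have {}inc : G (k.+1%:R * h) - G (k%:R * h) = G h - G 0.
    by rewrite inc; case: odd; rewrite expr0 mul1r.
  rewrite -[k.+1 in RHS]addn1 natrD mulrDl -IH ?(ltnW kn)// mul1r -inc; ring.
rewrite -nh Gk// mulf_neq0 ?gt_eqF// subr_gt0.
(* Integration by parts: the coefficient on [[0, h]] is the integral of
   [- f' sin (n x) / n > 0]. *)
pose K x := G x - f x * (sin (n%:R * x) / n%:R).
have dK (x : R) : 0 < x < h ->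
    is_derive x (1 : R) K (- (derive1 f x * (sin (n%:R * x) / n%:R))).
  move=> /andP[x0 xh]; have xpi : 0 < x < pi by rewrite x0 (lt_le_trans xh).
  have ? := f1 _ xpi; have ? : is_derive x 1 G (g x * cos (n%:R * x)).
    by apply: dG; rewrite nh; move: xpi => /andP[? ?]; rewrite !ltW.
  have sE : (fun x : R => sin (n%:R * x) / n%:R) = n%:R^-1 \*: (sin \o *%R n%:R).
    by apply/funext => y; rewrite /GRing.scale/= mulrC.
  rewrite /K; have dn := is_derive_mulrl n%:R x.
  have ? : is_derive x 1 (fun x : R => sin (n%:R * x) / n%:R) (cos (n%:R * x)).
    rewrite sE; apply: is_derive_eq; rewrite /GRing.scale/=.
    by rewrite mulrCA mulVf ?mulr1// gt_eqF.
  apply: is_derive_eq; rewrite gf; last by move: xpi => /andP[? ?]; rewrite !ltW.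
  by rewrite /GRing.scale/=; ring.
have : K 0 < K h.
  apply: (@gtr0_derive1_lt_cc _ K 0 h); rewrite ?in_itv/= ?lexx ?(ltW h0)//.
  - by move=> x; rewrite in_itv/= => /dK[].
  - move=> x; rewrite in_itv/= => xh; rewrite derive1E; have [_ ->] := dK _ xh.
    rewrite oppr_gt0 nmulr_rlt0 ?fneg// divr_gt0//; apply: sin_gt0_pi.
    by move: xh => /andP[x0 xh]; rewrite mulr_gt0//= -nh ltr_pM2l.
  - move=> x; apply: cvgB.
      move: x; apply: derivable_within_continuous => x; rewrite in_itv/= => /andP[x0 xh].
      by case: (dG x _) => //; rewrite x0 nh (le_trans xh).
    apply: cvgM.
      move: x; apply: continuous_subspaceW cf.
      by apply: subset_itvl; rewrite bnd_simp.
    apply: cvgM; last exact: cvg_cst.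
    move: x; apply: continuous_subspaceT.
    exact: continuous_sin_mul.
(* The boundary terms vanish because [sin (n x)] is 0 at both 0 and [h]. *)
by rewrite /K mulr0 sin0 nh sinpi mul0r mulr0 !subr0 mulr0 subr0.
Qed.

Lemma cos_coef_const (f : R -> R) (c : R) : (forall x : R, 0 <= x <= pi -> f x = c) ->
  cos_coef f 0 = c * pi /\ forall j, (0 < j)%N -> cos_coef f j = 0.
Proof.
move=> fc.
have cc : continuous (cst c : R -> R) by move=> x; exact: cvg_cst.
have cE (x : R) : 0 <= x <= pi -> cst c x = f x by move=> /fc ->.
split=> [|j j0].
  have dG (x : R) : 0 <= x <= pi ->
      is_derive x (1 : R) ( *%R c) (cst c x * cos (0%:R * x)).
    by move=> _; apply: (is_derive_eq (is_derive_mulrl _ _)); rewrite mul0r cos0 mulr1.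
  by rewrite (cos_coefE cc cE dG) mulr0 subr0.
have jR0 : j%:R != 0 :> R by rewrite pnatr_eq0 -lt0n.
pose G : R -> R := (c / j%:R) \*: (sin \o *%R j%:R).
have dG (x : R) : 0 <= x <= pi -> is_derive x (1 : R) G (cst c x * cos (j%:R * x)).
  move=> _; have dn := is_derive_mulrl j%:R x; rewrite /G.
  by apply: is_derive_eq; rewrite /GRing.scale/=; field.
by rewrite (cos_coefE cc cE dG) /G /= mulr0 sin0 sin_natpi subrr.
Qed.

(** The partial sums are constantly [u j] from index [j] on. *)
Lemma cvg0_single_term (u : nat -> R) (j : nat) : (forall n, n != j -> u n = 0) ->
  \sum_(0 <= n < k.+1) u n @[k --> \oo] --> (0 : R) -> u j = 0.
Proof.
move=> u0 cu; apply: (cvg_unique _ _ cu) => //.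
apply: cvg_near_cst; near=> k.
have jk : (j < k.+1)%N by rewrite ltnS; near: k; exact: nbhs_infty_ge.
by rewrite (bigD1_seq j) ?mem_index_iota ?iota_uniq//= big1 ?addr0.
Unshelve. all: by end_near. Qed.

End Main.

Theorem proposition1p4 (R : realType) (alpha beta : nat -> R)
    (F : nat -> R -> R) (hF : fucik_system alpha beta F) :
  omega_linearly_independent F.
Proof.
move=> eta eta0; case: hF => _ _ hG hF.
have F0 (x : R) : 0 <= x <= pi -> F 0 x = Num.sqrt 2 / 2.
  by move=> x0pi; apply: (hF 0%N); rewrite in_itv.
have [c00 c0j] := cos_coef_const F0.
have cF n : {within `[0, pi], continuous (F n)}.
  case: n => [|n]; last by have [[]] := hF n.+1.
  apply: (@subspace_eq_continuous _ _ _ (cst (Num.sqrt 2 / 2))).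
    by move=> x; rewrite inE/= in_itv/= => /F0.
  by move=> x; exact: cvg_cst.
have term j := @cvg0_single_term R (fun n => eta n * cos_coef (F n) j) j.
(* The [j]-th coefficient of the partial sums tends to 0; if only the term [n = j] survives, that
   term is 0. *)
have coef0 j : (forall n, n != j -> eta n * cos_coef (F n) j = 0) ->
    eta j * cos_coef (F j) j = 0.
  move/term; apply.
  under eq_fun do rewrite -(cos_coef_sum _ _ _ cF).2.
  by apply: cos_coef_cvg0 eta0 => k; exact: (cos_coef_sum _ 0 _ cF).1.
have etaS j : (0 < j)%N -> eta j = 0.
  elim/ltn_ind: j => j IH j0.
  have eigen n : (0 < n)%N ->
      (forall i, (0 < i < n)%N -> cos_coef (F n) i = 0) /\ cos_coef (F n) n != 0.
    case: n => // n _; have [sol f0 _] := hF n.+1.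
    exact: (eigenfunction_cos_coef (ltn0Sn n) (hG n.+1 (ltn0Sn n)) sol f0).
  have [_ cjj] := eigen j j0.
  (* Terms below [j] vanish by induction, or for [n = 0] because [F 0] is constant; terms above [j]
     vanish by triangularity. *)
  apply: (mulIf cjj); rewrite mul0r; apply: coef0 => n; rewrite neq_ltn => /orP[nj|jn].
    by case: n nj => [_|n nj]; rewrite ?c0j ?mulr0// IH// mul0r.
  have [cn0 _] := eigen n (leq_ltn_trans (leq0n j) jn).
  by rewrite cn0 ?mulr0// j0.
case=> [|n]; last exact: etaS.
(* Index 0 comes last: the mean of [F n] may be nonzero for [n >= 1], but those scalars are already
   known to vanish. *)
have c0 : cos_coef (F 0) 0 != 0.
  by rewrite c00 mulf_neq0 ?gt_eqF ?pi_gt0// divr_gt0// sqrtr_gt0.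
apply: (mulIf c0); rewrite mul0r; apply: coef0 => n n0.
by rewrite etaS ?mul0r// lt0n.
Qed.
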